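(* Let $\mathfrak{A}$ be a $C^*$-algebra and let $H$ and $K$ be non-zero Hilbert $\mathfrak{A}$-modules. Let $A\in\mathcal{L}(H)$, $B\in\mathcal{L}(K)$, $C\in\mathcal{L}(H,K)$, and let $T\in\mathcal{L}(H\oplus K)$ be defined by $$T=\begin{pmatrix} A & C^* \\ C & B\end{pmatrix}.$$ Then the following two statements are equivalent: (i) $T\ge 0$; (ii) $A\ge 0$, $B\ge 0$ and $$\left\|\langle Cu,v\rangle\right\|^2\le \|\langle Au,u\rangle\|\cdot \|\langle Bv,v\rangle\|\quad\text{for all } u\in H,\ v\in K.$$
   Context: Hilbert $\mathfrak{A}$-modules are right Hilbert $C^*$-modules over $\mathfrak{A}$, with $\mathfrak{A}$-valued inner product $\langle\cdot,\cdot\rangle$; the norm of $\langle\cdot,\cdot\rangle$ is taken in $\mathfrak{A}$. $\mathcal{L}(H,K)$ is the set of all adjointable operators from $H$ to $K$, $\mathcal{L}(H)=\mathcal{L}(H,H)$, and $C^*$ is the adjoint of $C$. An operator $A\in\mathcal{L}(H)$ is positive, written $A\ge 0$, if $\langle Ax,x\rangle\ge 0$ in $\mathfrak{A}$ for every $x\in H$. $H\oplus K=\{(x,y)^T: x\in H, y\in K\}$ is the Hilbert $\mathfrak{A}$-module with inner product $\langle (x_1,y_1)^T,(x_2,y_2)^T\rangle=\langle x_1,x_2\rangle+\langle y_1,y_2\rangle$, and operators on it are written as $2\times 2$ block matrices in the usual way. No closed-range or invertibility condition is imposed on $A$ or $B$. *)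

(* Defs.v *)
From HB Require Import structures.
From mathcomp Require Import all_boot all_order all_algebra.
From mathcomp Require Import all_classical all_reals all_analysis.
From mathcomp Require Import complex.

Set Implicit Arguments.
Unset Strict Implicit.
Unset Printing Implicit Defensive.

Import Order.TTheory GRing.Theory Num.Theory.
Import numFieldNormedType.Exports.
Local Open Scope ring_scope.
Local Open Scope complex_scope.

(* C*-algebras are complex and need not have a unit, so the product is not
   the one of a MathComp ring structure.  The scalar field is R[i]; its order
   is partial, and 0 <= k means that k is real and nonnegative. *)
HB.mixin Record isCStarAlgebra (R : realType) A
    of CompleteNormedModule R[i] A := {
  amul : A -> A -> A;
  star : A -> A;
  amulA : forall a b c, amul a (amul b c) = amul (amul a b) c;
  amulDl : forall a b c, amul (a + b) c = amul a c + amul b c;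
  amulDr : forall a b c, amul a (b + c) = amul a b + amul a c;
  amulZl : forall (k : R[i]) a b, amul (k *: a) b = k *: amul a b;
  amulZr : forall (k : R[i]) a b, amul a (k *: b) = k *: amul a b;
  normr_amul : forall a b, `|amul a b| <= `|a| * `|b|;
  starK : forall a, star (star a) = a;
  starD : forall a b, star (a + b) = star a + star b;
  starZ : forall (k : R[i]) a, star (k *: a) = Num.conj k *: star a;
  starM : forall a b, star (amul a b) = amul (star b) (star a);
  normr_cstar : forall a, `|amul (star a) a| = `|a| ^+ 2
}.

#[short(type="cstarAlgType")]
HB.structure Definition CStarAlgebra (R : realType) :=
  {A of CompleteNormedModule R[i] A & isCStarAlgebra R A}.

Section Positivity.
Context {R : realType} {A : cstarAlgType R}.
Implicit Types (a b : A) (k : R[i]).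

(* 1 - a is invertible in the unitization of A, with inverse 1 - b. *)
Definition quasi_invertible a : Prop :=
  exists b, a + b - amul a b = 0 /\ a + b - amul b a = 0.

(* The spectrum of a in the unitization of A: for k != 0, k - a is
   invertible there iff 1 - k^-1 a is.  If A already has a unit, this adds at
   most the point 0 to the spectrum of a in A. *)
Definition spectrum a : set R[i] :=
  [set k | k = 0 \/ ~ quasi_invertible (k^-1 *: a)].

Definition cpos a : Prop :=
  star a = a /\ (forall k, spectrum a k -> 0 <= k).

End Positivity.

(* Right A-modules with an A-valued Hermitian form, linear in the second
   variable.  The form need not be positive or definite at this level, which is
   that of the direct sum H (+) K, of adjointable operators and of their
   positivity.  When H and K are Hilbert modules, so is H (+) K: this needs
   that sums of positive elements of A are positive, and is not proved here. *)
HB.mixin Record isHermitianModule (R : realType) (A : cstarAlgType R) H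
    of GRing.Lmodule R[i] H := {
  ract : H -> A -> H;
  inner : H -> H -> A;
  ractDl : forall x y a, ract (x + y) a = ract x a + ract y a;
  ractDr : forall x a b, ract x (a + b) = ract x a + ract x b;
  ractA : forall x a b, ract x (amul a b) = ract (ract x a) b;
  ractZl : forall (k : R[i]) x a, ract (k *: x) a = k *: ract x a;
  ractZr : forall (k : R[i]) x a, ract x (k *: a) = k *: ract x a;
  innerDr : forall x y z, inner x (y + z) = inner x y + inner x z;
  innerZr : forall (k : R[i]) x y, inner x (k *: y) = k *: inner x y;
  inner_ract : forall x y a, inner x (ract y a) = amul (inner x y) a;
  inner_star : forall x y, inner y x = star (inner x y)
}.

#[short(type="hermitianModType")]
HB.structure Definition HermitianModule (R : realType) (A : cstarAlgType R) :=
  {H of GRing.Lmodule R[i] H & isHermitianModule R A H}.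

Notation "<[ x , y ]>" := (inner x y) (format "<[ x ,  y ]>").

Definition hnorm (R : realType) (A : cstarAlgType R) (H : hermitianModType A)
  (x : H) : R[i] := sqrtC `|<[x, x]>|.

HB.mixin Record isHilbertModule (R : realType) (A : cstarAlgType R) H
    of HermitianModule R A H := {
  inner_ge0 : forall x : H, cpos <[x, x]>;
  inner_eq0 : forall x : H, <[x, x]> = 0 -> x = 0;
  hnorm_complete : forall u : nat -> H,
    (forall e : R[i], 0 < e -> exists N : nat, forall m n : nat,
       (N <= m)%N -> (N <= n)%N -> hnorm (u m - u n) < e) ->
    exists l : H, forall e : R[i], 0 < e -> exists N : nat, forall n : nat,
       (N <= n)%N -> hnorm (u n - l) < e
}.

#[short(type="hilbertModType")]
HB.structure Definition HilbertModule (R : realType) (A : cstarAlgType R) :=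
  {H of HermitianModule R A H & isHilbertModule R A H}.

Section DirectSum.
Context {R : realType} {A : cstarAlgType R} {H K : hermitianModType A}.
Implicit Types (x y z : (H * K)%type) (a b : A).

Definition dsum_ract x a : (H * K)%type := (ract x.1 a, ract x.2 a).
Definition dsum_inner x y : A := <[x.1, y.1]> + <[x.2, y.2]>.

Fact dsum_ractDl x y a :
  dsum_ract (x + y) a = dsum_ract x a + dsum_ract y a.
Proof. by rewrite /dsum_ract /= !ractDl. Qed.

Fact dsum_ractDr x a b :
  dsum_ract x (a + b) = dsum_ract x a + dsum_ract x b.
Proof. by rewrite /dsum_ract /= !ractDr. Qed.

Fact dsum_ractA x a b :
  dsum_ract x (amul a b) = dsum_ract (dsum_ract x a) b.
Proof. by rewrite /dsum_ract /= !ractA. Qed.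

Fact dsum_ractZl (k : R[i]) x a : dsum_ract (k *: x) a = k *: dsum_ract x a.
Proof. by rewrite /dsum_ract /= !ractZl. Qed.

Fact dsum_ractZr (k : R[i]) x a : dsum_ract x (k *: a) = k *: dsum_ract x a.
Proof. by rewrite /dsum_ract /= !ractZr. Qed.

Fact dsum_innerDr x y z :
  dsum_inner x (y + z) = dsum_inner x y + dsum_inner x z.
Proof. by rewrite /dsum_inner /= !innerDr addrACA. Qed.

Fact dsum_innerZr (k : R[i]) x y :
  dsum_inner x (k *: y) = k *: dsum_inner x y.
Proof. by rewrite /dsum_inner /= !innerZr scalerDr. Qed.

Fact dsum_inner_ract x y a :
  dsum_inner x (dsum_ract y a) = amul (dsum_inner x y) a.
Proof. by rewrite /dsum_inner /= !inner_ract amulDl. Qed.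

Fact dsum_inner_star x y : dsum_inner y x = star (dsum_inner x y).
Proof. by rewrite /dsum_inner starD -!inner_star. Qed.

HB.instance Definition _ := isHermitianModule.Build R A (H * K)%type
  dsum_ractDl dsum_ractDr dsum_ractA dsum_ractZl dsum_ractZr
  dsum_innerDr dsum_innerZr dsum_inner_ract dsum_inner_star.

End DirectSum.

Notation "H \oplus K" := (H * K)%type (at level 50, only parsing).

(* Between Hilbert modules the adjoint is unique, and adjointable maps are
   automatically A-linear and bounded, so neither is a field. *)
Record adjointable (R : realType) (A : cstarAlgType R)
    (H K : hermitianModType A) := Adjointable {
  opfun :> H -> K;
  opadj : K -> H;
  opadjP : forall x y, <[opfun x, y]> = <[x, opadj y]>
}.

Notation "''L' ( H , K )" := (adjointable H K) (format "''L' ( H ,  K )").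
Notation "''L' ( H )" := (adjointable H H) (format "''L' ( H )").

Section Operators.
Context {R : realType} {A : cstarAlgType R}.
Implicit Types H K : hermitianModType A.

Fact adjoint_subproof H K (C : 'L(H, K)) y x :
  <[opadj C y, x]> = <[y, C x]>.
Proof. by rewrite inner_star -opadjP -inner_star. Qed.

Definition adjoint H K (C : 'L(H, K)) : 'L(K, H) :=
  Adjointable (adjoint_subproof C).

Section Block.
Context {H1 H2 K1 K2 : hermitianModType A}.
Variables (T11 : 'L(H1, K1)) (T12 : 'L(H2, K1)).
Variables (T21 : 'L(H1, K2)) (T22 : 'L(H2, K2)).

Definition block_fun (x : H1 \oplus H2) : K1 \oplus K2 :=
  (T11 x.1 + T12 x.2, T21 x.1 + T22 x.2).
Definition block_adj (y : K1 \oplus K2) : H1 \oplus H2 :=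
  (opadj T11 y.1 + opadj T21 y.2, opadj T12 y.1 + opadj T22 y.2).

Fact block_subproof (x : H1 \oplus H2) (y : K1 \oplus K2) :
  <[block_fun x, y]> = <[x, block_adj y]>.
Proof.
have innerDl (L : hermitianModType A) (u v w : L) :
    <[u + v, w]> = <[u, w]> + <[v, w]>.
  by rewrite inner_star innerDr starD -!inner_star.
rewrite /inner /= /dsum_inner /= !innerDl !innerDr !opadjP.
by rewrite addrACA.
Qed.

Definition block_op : 'L(H1 \oplus H2, K1 \oplus K2) :=
  Adjointable block_subproof.

End Block.

Definition op_ge0 H (T : 'L(H)) : Prop := forall x, cpos <[T x, x]>.

End Operators.

(* Main.v *)
Require Import Defs.
From HB Require Import structures.
From mathcomp Require Import all_boot all_order all_algebra.
From mathcomp Require Import all_classical all_reals all_analysis.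
From mathcomp Require Import complex.
From mathcomp Require Import ring lra.

(** The proof takes place in the unitization of the C*-algebra CA, where the
    quadratic form of T at (u, v) is a + b + c + c^* with a = <Au, u>,
    b = <Bv, v> and c = <Cu, v>.

    From T >= 0 to the inequality: inserting (u, - t v c^* ) in the form gives
    a - 2t c c^* + t^2 c b c^* >= 0 for all t >= 0.  For s > |b| one has
    c b c^* <= s c c^*, so t = 1/s yields 0 <= c c^* <= s a, and
    |c|^2 <= s |a| by monotonicity of the norm ([nrm_of_pos_block]).

    From the inequality to T >= 0: inserting u x and v y turns the hypothesis
    into |x^* c y|^2 <= |x^* a x| |y^* b y| for all x, y in CA.  For e > 0, let
    p and q be the square roots of a + e and b + e.  The hypothesis, applied to
    elements of the form p^-1 w and q^-1 z, says that d = p^-1 c q^-1 is a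
    contraction.  Then p^2 + q^2 + p d q + (p d q)^*
    = (d^* p + q)^* (d^* p + q) + p (1 - d d^* ) p is positive, and e tends to 0
    ([pos_block_of_contraction], [pos_of_form_bound]).

    This needs square roots, the closed cone of positive elements, x^* x >= 0,
    and the link with the spectrum by which positivity is defined.  A
    functional calculus is avoided: an element x is called positive when it is
    self-adjoint and |t - x| <= t for some t, a condition visibly stable under
    sums and limits.  For such x, x + e is a multiple of 1 - y with |y| < 1 and
    so has a square root, obtained as a fixed point of a contraction
    ([sqrt_one_sub]).  If a and b are self-adjoint and commute, then
    a^2 + b^2 = |a + ib|^2 bounds |a| ([nrm_circle]); hence squares are
    positive, products of commuting positive elements are positive, and
    -t <= x <= t implies |x| <= t.  That a self-adjoint x is positive as soon as
    all x + e are invertible follows by looking at the least e >= 0 for which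
    x + e is positive ([pos_of_inv]); conversely the resolvent of a positive
    element exists off the half-line ([inv_resolvent]).  Finally x^* x >= 0 is
    Kaplansky's theorem ([pos_adjM]).  The norm of the unitization is the larger of
    the operator norm on CA and the modulus of the scalar part; this is a
    complete C*-norm whether or not CA has a unit. *)

Set Implicit Arguments.
Unset Strict Implicit.
Unset Printing Implicit Defensive.

Import Order.TTheory GRing.Theory Num.Theory.
Import numFieldNormedType.Exports.
Local Open Scope ring_scope.
Local Open Scope complex_scope.

Local Notation normc := ComplexField.Normc.normc.

(** * Unital C*-algebras: norm, adjoint and real scalars *)

(** The norm takes its values in R, where the order is total, instead of R[i].
    The fields are inequalities because they are what has to be checked for a
    norm defined as an infimum; the equalities follow. *)
HB.mixin Record isUnitalCStar (R : realType) M of GRing.Algebra R[i] M := {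
  adj : M -> M;
  nrm : M -> R;
  adjK : forall x, adj (adj x) = x;
  adjD : forall x y, adj (x + y) = adj x + adj y;
  adjZ : forall (k : R[i]) x, adj (k *: x) = conjc k *: adj x;
  adjM : forall x y, adj (x * y) = adj y * adj x;
  nrm_ge0 : forall x, 0 <= nrm x;
  nrm_eq0 : forall x, nrm x = 0 -> x = 0;
  ler_nrmD : forall x y, nrm (x + y) <= nrm x + nrm y;
  ler_nrmZ : forall (k : R[i]) x, nrm (k *: x) <= normc k * nrm x;
  ler_nrmM : forall x y, nrm (x * y) <= nrm x * nrm y;
  ler_nrm_cstar : forall x, nrm x ^+ 2 <= nrm (adj x * x);
  nrm_complete : forall u : nat -> M,
    (forall e, 0 < e -> exists N : nat, forall m n : nat,
       (N <= m)%N -> (N <= n)%N -> nrm (u m - u n) < e) ->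
    exists l, forall e, 0 < e -> exists N : nat, forall n : nat,
       (N <= n)%N -> nrm (u n - l) < e
}.

#[short(type="unitalCStarType")]
HB.structure Definition UnitalCStar (R : realType) :=
  {M of GRing.Algebra R[i] M & isUnitalCStar R M}.

Section NormAndAdjoint.
Context {R : realType} {M : unitalCStarType R}.
Implicit Types (x y z p : M) (r s t e : R).

Notation "r *:r x" := (r%:C *: x : M) (at level 40).
Notation "r %:r" := ((r%:C)%:A : M) (at level 2, format "r %:r").

Lemma nrm0 : nrm (0 : M) = 0.
Proof.
have := ler_nrmZ 0 (0 : M); rewrite scale0r ComplexField.Normc.normc0 mul0r.
by move=> h; apply/eqP; rewrite eq_le h nrm_ge0.
Qed.

Lemma ler_nrmZr r x : 0 <= r -> nrm (r *:r x) <= r * nrm x.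
Proof.
move=> r0; apply: le_trans (ler_nrmZ _ _) _.
by rewrite /normc /= expr0n addr0 sqrtr_sqr ger0_norm.
Qed.

Lemma nrmN x : nrm (- x) = nrm x.
Proof.
have H y : nrm (- y) <= nrm y.
  rewrite -scaleN1r; apply: le_trans (ler_nrmZ _ _) _.
  by rewrite normcN ComplexField.Normc.normc1 mul1r.
by apply/eqP; rewrite eq_le H -{1}(opprK x) H.
Qed.

Lemma nrmBC x y : nrm (x - y) = nrm (y - x).
Proof. by rewrite -nrmN opprB. Qed.

Lemma nrm_tri y x z : nrm (x - z) <= nrm (x - y) + nrm (y - z).
Proof. by rewrite -{1}(subrK y x) -addrA ler_nrmD. Qed.

Lemma adj_one : adj 1 = 1 :> M.
Proof. by rewrite -[LHS]mulr1 -{2}(adjK 1) -adjM mulr1 adjK. Qed.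

(** The C*-identity gives |1|^2 <= |1|; the zero algebra is not excluded,
    so equality may fail. *)
Lemma nrm1_le1 : nrm (1 : M) <= 1.
Proof.
have := ler_nrm_cstar (1 : M); rewrite adj_one mul1r; have := nrm_ge0 (1 : M); nra.
Qed.

Lemma nrm_real_le r : 0 <= r -> nrm r%:r <= r.
Proof. by move=> r0; apply: le_trans (ler_nrmZr _ r0) _; rewrite ler_piMr // nrm1_le1. Qed.

Lemma adjZr r x : adj (r *:r x) = r *:r adj x.
Proof. by rewrite adjZ conjc_real. Qed.

Lemma adj_real r : adj r%:r = r%:r.
Proof. by rewrite adjZr adj_one. Qed.

Lemma adjN x : adj (- x) = - adj x.
Proof. by rewrite -scaleN1r adjZ rmorphN rmorph1 scaleN1r. Qed.

Lemma adjB x y : adj (x - y) = adj x - adj y.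
Proof. by rewrite adjD adjN. Qed.

Lemma adj_zero : adj 0 = 0 :> M.
Proof. by rewrite -(subrr (1 : M)) adjB adj_one. Qed.

Lemma nrm_adj x : nrm (adj x) = nrm x.
Proof.
have H y : nrm y <= nrm (adj y).
  have := le_trans (ler_nrm_cstar y) (ler_nrmM _ _).
  have := nrm_ge0 y; have := nrm_ge0 (adj y); nra.
by apply/eqP; rewrite eq_le H andbT -{2}(adjK x) H.
Qed.

Lemma nrm_adjM x : nrm (adj x * x) = nrm x ^+ 2.
Proof.
apply/eqP; rewrite eq_le ler_nrm_cstar andbT.
by apply: le_trans (ler_nrmM _ _) _; rewrite nrm_adj expr2.
Qed.

Lemma rscalarD r s : (r + s)%:r = r%:r + s%:r.
Proof. by rewrite rmorphD scalerDl. Qed.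

Lemma rscalarB r s : (r - s)%:r = r%:r - s%:r.
Proof. by rewrite rmorphB scalerBl. Qed.

Lemma rscalar_mul r x : r%:r * x = r *:r x.
Proof. by rewrite -scalerAl mul1r. Qed.

Lemma mul_rscalar r x : x * r%:r = r *:r x.
Proof. by rewrite -scalerAr mulr1. Qed.

Lemma comm_real r x : GRing.comm r%:r x.
Proof. by rewrite /GRing.comm rscalar_mul mul_rscalar. Qed.

Lemma scalerrA r t x : r *:r (t *:r x) = (r * t) *:r x.
Proof. by rewrite scalerA -rmorphM. Qed.

Lemma scalerr1 x : 1 *:r x = x.
Proof. by rewrite rmorph1 scale1r. Qed.

End NormAndAdjoint.

(** * Fixed points, inverses and square roots near the unit *)

Section FixedPoints.
Context {R : realType} {M : unitalCStarType R}.
Implicit Types (x y z p : M) (r s t e : R).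

Notation "r *:r x" := (r%:C *: x : M) (at level 40).
Notation "r %:r" := ((r%:C)%:A : M) (at level 2, format "r %:r").

Definition nrm_closed (S : M -> Prop) : Prop :=
  forall x, (forall e, 0 < e -> exists2 y, S y & nrm (x - y) <= e) -> S x.

Lemma nrm_le0_eq x : (forall e, 0 < e -> nrm x <= e) -> x = 0.
Proof.
move=> H; apply: nrm_eq0; apply/eqP; rewrite eq_le nrm_ge0 andbT.
by apply/ler_addgt0Pl => e e0; rewrite addr0; apply: H.
Qed.

(** Banach's theorem on a closed set S.  The set is there to carry what the fixed
    point must inherit from the iterates: self-adjointness, commutation, a bound
    on the norm. *)
Lemma contraction_fixpoint (S : M -> Prop) (f : M -> M) (q : R) :
    0 <= q < 1 -> nrm_closed S -> S 0 -> (forall x, S x -> S (f x)) ->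
    (forall x y, S x -> S y -> nrm (f x - f y) <= q * nrm (x - y)) ->
  exists2 x, S x & f x = x.
Proof.
move=> /andP[q0 q1] Scl S0 Sf fq.
pose u n := iter n f 0.
have Su n : S (u n) by elim: n => //= n; apply: Sf.
pose B := nrm (u 1%N) / (1 - q).
have q1' : 1 - q != 0 by lra.
have B0 : 0 <= B by rewrite /B divr_ge0 ?nrm_ge0 //; lra.
have bnd k : nrm (u k - u 0%N) <= B.
  elim: k => [|k IH]; first by rewrite subrr nrm0.
  apply: le_trans (nrm_tri (u 1%N) _ _) _.
  have BE : q * B + nrm (u 1%N) = B by rewrite /B; field.
  have := fq _ _ (Su k) (Su 0%N); have := ler_wpM2l q0 IH.
  by rewrite -[f (u k)]/(u k.+1) -[f (u 0%N)]/(u 1%N) [u 1%N - _]subr0; lra.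
(* every iterate is within B of the start, hence within q^n B of the n-th one after n steps *)
have bndn n k : nrm (u (n + k)%N - u n) <= q ^+ n * B.
  elim: n => [|n IH]; first by rewrite mul1r bnd.
  rewrite addSn /= exprS -mulrA.
  by apply: le_trans (fq _ _ (Su _) (Su _)) _; rewrite ler_wpM2l.
have small e : 0 < e -> exists N : nat, forall n, (N <= n)%N -> q ^+ n * B < e.
  move=> e0.
  have qn : (q ^+ n @[n --> \oo] --> (0 : R))%classic by apply: cvg_expr; rewrite ger0_norm.
  have e1 : 0 < e / (B + 1) by rewrite divr_gt0 //; lra.
  have [N _ HN] := cvgr0_norm_lt _ qn _ e1.
  exists N => n Nn; have := HN n Nn => /=; rewrite ger0_norm ?exprn_ge0 //.
  rewrite ltr_pdivlMr; last by lra.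
  by have : 0 <= q ^+ n by [rewrite exprn_ge0]; nra.
have [l Hl] : exists l, forall e, 0 < e -> exists N : nat, forall n : nat,
       (N <= n)%N -> nrm (u n - l) < e.
  apply: nrm_complete => e e0; have [N HN] := small _ (divr_gt0 e0 (ltr0n _ 2)).
  exists N => m n Nm Nn.
  apply: le_lt_trans (nrm_tri (u N) _ _) _.
  have := bndn N (m - N)%N; have := bndn N (n - N)%N; have := HN N (leqnn _).
  rewrite !subnKC // (nrmBC (u N)); lra.
have Sl : S l.
  apply: Scl => e e0; have [N HN] := Hl e e0; exists (u N) => //.
  by rewrite nrmBC ltW // HN.
exists l => //; apply/eqP; rewrite -subr_eq0; apply/eqP; apply: nrm_le0_eq => e e0.
have [N HN] := Hl _ (divr_gt0 e0 (ltr0n _ 2)).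
have H1 := HN N (leqnn _); have H2 := HN N.+1 (leqnSn _).
have := fq _ _ Sl (Su N); have := nrm_tri (u N.+1) (f l) l.
rewrite /= (nrmBC l) in H1 H2 *; have := nrm_ge0 (u N - l); nra.
Qed.

Lemma closedI (S1 S2 : M -> Prop) : nrm_closed S1 -> nrm_closed S2 ->
  nrm_closed (fun x => S1 x /\ S2 x).
Proof.
move=> h1 h2 x H; split; [apply: h1|apply: h2] => e /H[y [] Sy1 Sy2 xy]; by exists y.
Qed.

Lemma selfadj_closed : nrm_closed (fun x => adj x = x).
Proof.
move=> x H; apply/eqP; rewrite -subr_eq0; apply/eqP; apply: nrm_le0_eq => e e0.
have [y ya xy] := H _ (divr_gt0 e0 (ltr0n _ 2)).
have := nrm_tri y (adj x) x; rewrite -{1}ya -adjB nrm_adj (nrmBC y); lra.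
Qed.

Lemma comm_closed z : nrm_closed (fun x => GRing.comm x z).
Proof.
move=> x H; apply/eqP; rewrite -subr_eq0; apply/eqP; apply: nrm_le0_eq => e e0.
have z0 := nrm_ge0 z.
have [|y yz xy] := H (e / (2 * (nrm z + 1))).
  by rewrite divr_gt0 // mulr_gt0 //; lra.
have -> : x * z - z * x = (x - y) * z + z * (y - x).
  by rewrite mulrBl mulrBr yz addrA subrK.
apply: le_trans (ler_nrmD _ _) _.
have := ler_nrmM (x - y) z; have := ler_nrmM z (y - x); rewrite (nrmBC y x).
move: xy; rewrite ler_pdivlMr; last by lra.
have := nrm_ge0 (x - y); nra.
Qed.

Lemma nrm_le_closed r : nrm_closed (fun x => nrm x <= r).
Proof.
move=> x H; apply/ler_addgt0Pl => e /H[y yr xy].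
by have := nrm_tri y x 0; rewrite !subr0; lra.
Qed.

(** y is in the bicommutant of x.  This is all that is needed of y being a
    function of x, and it makes two such functions commute. *)
Definition bicomm x y : Prop := forall z, GRing.comm x z -> GRing.comm y z.

Lemma bicomm_closed x : nrm_closed (bicomm x).
Proof.
move=> y H z xz; apply: comm_closed => e /H[y' By yy']; exists y' => //; exact: By.
Qed.

Definition invertible x : Prop := exists2 y, x * y = 1 & y * x = 1.

(** The inverse is the fixed point of y |-> 1 + x y.  Looking for it in the commutant
    of x makes it a two-sided inverse. *)
Lemma neumann x : nrm x < 1 -> invertible (1 - x).
Proof.
move=> x1.
have [|||y xy|y z xy xz|y xy yE] := @contraction_fixpoint
  (fun y => GRing.comm x y) (fun y => 1 + x * y) (nrm x).
- by rewrite nrm_ge0.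
- move=> y H; apply/esym; apply: comm_closed => e /H[z]; by exists z.
- exact: commr0.
- by apply: commrD; [exact: commr1 | apply: commrM].
- by rewrite opprD addrACA subrr add0r -mulrBr ler_nrmM.
by exists y; rewrite ?mulrBl ?mulrBr -?xy ?mul1r ?mulr1 -{1}yE addrK.
Qed.

(** 1 - y is a root of 1 - x iff y = (x + y^2) / 2, and on the ball of radius r the
    right-hand side is a contraction of ratio r. *)
Lemma sqrt_one_sub x r : 0 <= r < 1 -> adj x = x -> nrm x <= r ->
  exists y, [/\ adj y = y, nrm y <= r, (1 - y) * (1 - y) = 1 - x & bicomm x y].
Proof.
move=> r01 xa xr; have /andP[r0 r1] := r01.
have half0 : 0 <= 2^-1 :> R by lra.
pose S y := adj y = y /\ nrm y <= r /\ bicomm x y.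
have [||y [ya [yr By]]|y z [ya [yr By]] [za [zr Bz]]|y [ya [yr By]] yE] :=
  @contraction_fixpoint S (fun y => 2^-1 *:r (x + y * y)) r r01.
- exact: closedI selfadj_closed (closedI (@nrm_le_closed r) (@bicomm_closed x)).
- by split; [rewrite adj_zero|split; [rewrite nrm0|move=> z _; apply: commr_sym; apply: commr0]].
- split; [|split].
  + by rewrite adjZr adjD adjM xa ya.
  + apply: le_trans (ler_nrmZr _ half0) _.
    have := ler_nrmD x (y * y); have := ler_nrmM y y; have := nrm_ge0 y; nra.
  + move=> z xz; rewrite /GRing.comm -scalerAl -scalerAr; congr (_ *: _).
    apply/commr_sym/commrD; first exact: commr_sym.
    by apply: commrM; apply/commr_sym/By.
- have yz : GRing.comm y z by apply: By; apply/commr_sym/Bz.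
  rewrite -scalerBr opprD addrACA subrr add0r.
  have -> : y * y - z * z = (y + z) * (y - z).
    by rewrite mulrBr !mulrDl yz opprD addrA addrK.
  apply: le_trans (ler_nrmZr _ half0) _.
  have := ler_nrmM (y + z) (y - z); have := ler_nrmD y z.
  have := nrm_ge0 (y - z); have := nrm_ge0 (y + z); nra.
exists y; split=> //.
have /(congr1 (fun v => 2 *:r v)) : 2^-1 *:r (x + y * y) = y by [].
rewrite scalerA -rmorphM /= divff // rmorph1 scale1r => E.
have {}E : x + y * y = y + y by rewrite E rmorphD rmorph1 scalerDl scale1r.
have -> : x = y + y - y * y by rewrite -E addrK.
by rewrite mulrBl mul1r mulrBr mulr1 !opprB opprD !addrA (addrAC 1).
Qed.

End FixedPoints.

(** * Positive elements *)

Section PositiveElements.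
Context {R : realType} {M : unitalCStarType R}.
Implicit Types (x y z p : M) (r s t e : R).

Notation "r *:r x" := (r%:C *: x : M) (at level 40).
Notation "r %:r" := ((r%:C)%:A : M) (at level 2, format "r %:r").

(** For a self-adjoint x the condition says that the spectrum lies in a disc with
    center t and radius t.  Once it holds for some t it holds for all larger ones
    and, by [pos_nrm], for all t above the norm of x. *)
Definition pos x : Prop :=
  adj x = x /\ exists2 t : R, 0 <= t & nrm (t%:r - x) <= t.

Lemma bicommZ r x : bicomm x (r *:r x).
Proof. by move=> z xz; rewrite /GRing.comm -scalerAl xz -scalerAr. Qed.

Lemma bicomm_trans x y z : bicomm x y -> bicomm y z -> bicomm x z.
Proof. by move=> xy yz w /xy /yz. Qed.

Lemma bicomm_realB r x : bicomm x (r%:r - x).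
Proof.
by move=> z xz; apply/commr_sym/commrB; [exact/commr_sym/comm_real|exact: commr_sym].
Qed.

(** The shift by e makes x + e = (t + e) (1 - w) with |w| <= t / (t + e) < 1. *)
Lemma sqrt_shift x t e : adj x = x -> 0 <= t -> nrm (t%:r - x) <= t -> 0 < e ->
  exists s : M, [/\ adj s = s, s * s = x + e%:r, bicomm x s & pos s].
Proof.
move=> xa t0 xt e0; pose T := t + e; have T0 : 0 < T by rewrite /T; lra.
pose w := T^-1 *:r (t%:r - x).
have wa : adj w = w by rewrite adjZr adjB adj_real xa.
have wn : nrm w <= t / T.
  apply: le_trans (ler_nrmZr _ _) _; first by rewrite invr_ge0 ltW.
  by rewrite mulrC ler_pM2r ?invr_gt0.
have r01 : 0 <= t / T < 1.
  by rewrite divr_ge0 //= ?(ltW T0) // ltr_pdivrMr // mul1r /T; lra.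
have [y [ya yn yE yB]] := sqrt_one_sub r01 wa wn.
have sT := sqrtr_ge0 T.
exists (Num.sqrt T *:r (1 - y)); split.
- by rewrite adjZr adjB adj_one ya.
- rewrite -scalerAl -scalerAr yE scalerrA -expr2 sqr_sqrtr ?ltW // scalerBr.
  by rewrite /w scalerrA divff ?gt_eqF // scalerr1 /T rscalarD opprB addrCA [t%:r + _]addrC addrK.
- have Bw : bicomm x w by exact: bicomm_trans (@bicomm_realB t x) (@bicommZ _ _).
  have B1 : bicomm y (1 - y) by have := @bicomm_realB 1 y; rewrite scalerr1.
  exact: bicomm_trans Bw (bicomm_trans yB (bicomm_trans B1 (@bicommZ _ _))).
- split; first by rewrite adjZr adjB adj_one ya.
  exists (Num.sqrt T) => //.
  rewrite scalerBr opprB addrCA subrr addr0.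
  apply: le_trans (ler_nrmZr _ sT) _; rewrite ler_piMr //.
  by case/andP: r01 => _ /ltW; apply: le_trans.
Qed.

(** The normal element W = a + i b satisfies W^* W = c, and a is its real part. *)
Lemma nrm_circle (a b : M) (c : R) : adj a = a -> adj b = b -> GRing.comm a b ->
  a * a + b * b = c%:r -> 0 <= c -> nrm a ^+ 2 <= c.
Proof.
move=> aa ba ab E c0; pose W := a + 'i *: b.
have Wa : adj W = a - 'i *: b.
  rewrite adjD adjZ aa ba /= -scaleNr; congr (_ + _ *: _).
  by apply/eqP; rewrite eq_complex /= oppr0 !eqxx.
have WW : adj W * W = c%:r.
  rewrite Wa -E mulrBl !mulrDr -!scalerAl -!scalerAr scalerA ab.
  have -> : 'i * 'i = -1 :> R[i] by rewrite -expr2 sqr_i.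
  rewrite scaleN1r opprD opprK addrA.
  by rewrite [_ + 'i *: _ - _]addrK.
have : nrm W ^+ 2 <= c by rewrite -nrm_adjM WW nrm_real_le.
have : nrm a <= nrm W.
  have -> : a = 2^-1 *:r (W + adj W).
    rewrite Wa addrACA subrr addr0 -{2 3}(scalerr1 a) -scalerDl -rmorphD scalerrA.
    by rewrite mulVf ?scalerr1.
  have h : 0 <= 2^-1 :> R by lra.
  apply: le_trans (ler_nrmZr _ h) _.
  by have := ler_nrmD W (adj W); rewrite nrm_adj; lra.
have := nrm_ge0 a; nra.
Qed.

Lemma nrm_sqr (a : M) : adj a = a -> nrm (a * a) = nrm a ^+ 2.
Proof. by move=> aa; rewrite -{1}aa nrm_adjM. Qed.

(** For t slightly larger than |a|^2, t - a^2 has a self-adjoint root s, and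
    [nrm_circle] bounds s because s^2 + a^2 = t. *)
Lemma nrm_real_sqr t (a : M) : adj a = a -> nrm a ^+ 2 <= t -> nrm (t%:r - a * a) <= t.
Proof.
move=> aa at_; have t0 : 0 <= t by apply: le_trans at_; rewrite sqr_ge0.
apply/ler_addgt0Pl => e e0; have e2 : 0 < e / 2 by lra.
have ya : adj (t%:r - a * a) = t%:r - a * a by rewrite adjB adj_real adjM aa.
have ty : nrm (t%:r - (t%:r - a * a)) <= t by rewrite opprB addrC subrK nrm_sqr.
have [s [sa sE sB _]] := sqrt_shift ya t0 ty e2.
have ss : nrm s ^+ 2 <= t + e / 2.
  apply: (@nrm_circle s a) => //; last by lra.
    apply: sB; apply/commr_sym/commrB; first exact/commr_sym/comm_real.
    by apply: commrM.
  by rewrite sE addrAC subrK rscalarD.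
have -> : t%:r - a * a = s * s - (e / 2)%:r by rewrite sE addrK.
have := ler_nrmD (s * s) (- (e / 2)%:r); rewrite nrmN nrm_sqr //.
have := nrm_real_le (M := M) (ltW e2); lra.
Qed.

Lemma pos_sqr (a : M) : adj a = a -> pos (a * a).
Proof.
move=> aa; split; first by rewrite adjM aa.
by exists (nrm a ^+ 2); rewrite ?sqr_ge0 ?nrm_real_sqr.
Qed.

Lemma pos_sqrt_shift x e : pos x -> 0 < e ->
  exists s : M, [/\ adj s = s, s * s = x + e%:r, bicomm x s & pos s].
Proof. by case=> xa [t t0 xt] e0; exact: sqrt_shift xa t0 xt e0. Qed.

(** Up to e, x is a square, for which [nrm_real_sqr] gives every t. *)
Lemma pos_nrm x t : pos x -> nrm x <= t -> nrm (t%:r - x) <= t.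
Proof.
move=> px xt; apply/ler_addgt0Pr => e e0.
have [s [sa sE _ _]] := pos_sqrt_shift px e0.
have -> : t%:r - x = (t + e)%:r - s * s by rewrite sE rscalarD opprD addrACA subrr addr0.
apply: nrm_real_sqr => //; rewrite -nrm_sqr // sE; apply: le_trans (ler_nrmD _ _) _.
by rewrite lerD // nrm_real_le // ltW.
Qed.

Lemma pos_closed : nrm_closed (pos : M -> Prop).
Proof.
move=> x H; split.
  by apply: selfadj_closed => e /H[y [ya _] xy]; exists y.
exists (nrm x + 1) => [|]; first by have := nrm_ge0 x; lra.
apply/ler_addgt0Pl => e e0.
(* |y| <= |x| + 1 as soon as |x - y| <= 1, so one t serves all approximants *)
pose d := Num.min e 1.
have d0 : 0 < d by rewrite lt_min e0 /=; lra.
have [y py xy] := H d d0.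
have [de d1] : d <= e /\ d <= 1 by rewrite !ge_min !lexx orbT.
have yn : nrm y <= nrm x + 1.
  by have := nrm_tri x y 0; rewrite !subr0 nrmBC; lra.
have -> : (nrm x + 1)%:r - x = ((nrm x + 1)%:r - y) + (y - x) by rewrite addrA subrK.
by have := pos_nrm py yn; have := ler_nrmD ((nrm x + 1)%:r - y) (y - x); rewrite (nrmBC y); lra.
Qed.

Lemma pos_shift_closed x : (forall e, 0 < e -> pos (x + e%:r)) -> pos x.
Proof.
move=> H; apply: pos_closed => e e0; exists (x + e%:r); first exact: H.
by rewrite opprD addrA subrr add0r nrmN nrm_real_le // ltW.
Qed.

Lemma posD x y : pos x -> pos y -> pos (x + y).
Proof.
move=> [xa [t t0 xt]] [ya [r r0 yr]]; split; first by rewrite adjD xa ya.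
exists (t + r); first by rewrite addr_ge0.
rewrite rscalarD opprD addrACA; apply: le_trans (ler_nrmD _ _) _; exact: lerD.
Qed.

Lemma posZ r x : 0 <= r -> pos x -> pos (r *:r x).
Proof.
move=> r0 [xa [t t0 xt]]; split; first by rewrite adjZr xa.
exists (r * t); first by rewrite mulr_ge0.
rewrite -scalerrA -scalerBr; apply: le_trans (ler_nrmZr _ r0) _; exact: ler_wpM2l.
Qed.

Lemma pos_real r : 0 <= r -> pos r%:r.
Proof.
move=> r0; split; first exact: adj_real.
by exists r => //; rewrite subrr nrm0.
Qed.

Lemma pos_realB x t : adj x = x -> nrm x <= t -> pos (t%:r - x).
Proof.
move=> xa xt; have t0 := le_trans (nrm_ge0 x) xt.
split; first by rewrite adjB adj_real xa.
by exists t => //; rewrite opprB addrC subrK.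
Qed.

(** Up to e, x and y have commuting roots s and r, and (s r)^2 is a square. *)
Lemma posM_comm x y : pos x -> pos y -> GRing.comm x y -> pos (x * y).
Proof.
move=> px py xy; apply: pos_closed => d d0.
have x0 := nrm_ge0 x; have y0 := nrm_ge0 y.
pose N := nrm x + nrm y + 1; have N0 : 0 < N by rewrite /N; lra.
pose e := Num.min (d / N) 1.
have e0 : 0 < e by rewrite lt_min divr_gt0 //=; lra.
have [ed e1] : e <= d / N /\ e <= 1 by rewrite !ge_min !lexx orbT.
have [s [sa sE sB _]] := pos_sqrt_shift px e0.
have [r [ra rE rB _]] := pos_sqrt_shift py e0.
have sr : GRing.comm s r by apply: sB; apply/commr_sym/rB/commr_sym.
exists (s * r * (s * r)); first by apply: pos_sqr; rewrite adjM sa ra.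
rewrite -mulrA (mulrA r) -sr mulrA mulrA sE -mulrA rE.
rewrite mulrDl mulrDr -addrA opprD addrA subrr add0r nrmN rscalar_mul mul_rscalar.
move: ed; rewrite ler_pdivlMr // => ed.
apply: le_trans (ler_nrmD _ _) _.
have := ler_nrmZr x (ltW e0); have := ler_nrmZr (y + e%:r) (ltW e0).
have := ler_nrmD y e%:r; have := nrm_real_le (M := M) (ltW e0).
rewrite /N in ed; nra.
Qed.

Lemma comm_subsqr x y : GRing.comm x y -> (x - y) * (x + y) = x * x - y * y.
Proof. by move=> xy; rewrite mulrBl !mulrDr xy opprD addrA addrK. Qed.

Lemma comm_sub_add x y : GRing.comm x y -> GRing.comm (x - y) (x + y).
Proof.
by move=> xy; apply/commr_sym/commrB; apply/commr_sym/commrD => //; apply: commr_sym.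
Qed.

(** t^2 - x^2 = (t - x) (t + x) is positive, so up to e it is s^2 with
    s^2 + x^2 = t^2, and [nrm_circle] applies. *)
Lemma nrm_le_of_pos x t : 0 <= t -> pos (t%:r - x) -> pos (t%:r + x) -> nrm x <= t.
Proof.
move=> t0 p1 p2.
have xa : adj x = x.
  by case: p2; rewrite adjD adj_real => /addrI.
have tx : GRing.comm t%:r x by exact: comm_real.
have cc : GRing.comm (t%:r - x) (t%:r + x).
  exact: comm_sub_add.
have := posM_comm p1 p2 cc; rewrite comm_subsqr // => pp.
have : nrm x ^+ 2 <= t ^+ 2.
  apply/ler_addgt0Pl => e e0; have [s [sa sE sB _]] := pos_sqrt_shift pp e0.
  apply: (@nrm_circle x s) => //.
  - apply/commr_sym/sB; apply/commr_sym/commrB; exact: commrM.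
  - by rewrite sE addrA addrC [x * x + _]addrC subrK rscalar_mul scalerrA rscalarD expr2.
  - by rewrite addr_ge0 ?sqr_ge0 // ltW.
by rewrite ler_sqr ?nnegrE ?nrm_ge0.
Qed.

Lemma ler_nrm_pos x y : pos x -> pos (y - x) -> nrm x <= nrm y.
Proof.
move=> px pyx; have py : pos y by rewrite -(subrK x y); exact: posD.
apply: nrm_le_of_pos; rewrite ?nrm_ge0 //; last exact: posD (pos_real (nrm_ge0 _)) px.
rewrite -(subrK y _%:r) -addrA; apply: posD => //.
by apply: pos_realB => //; case: py.
Qed.

End PositiveElements.

(** * Positivity and invertibility *)

Section PositivityInvertibility.
Context {R : realType} {M : unitalCStarType R}.
Implicit Types (x y z p : M) (r s t e : R).

Notation "r *:r x" := (r%:C *: x : M) (at level 40).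
Notation "r %:r" := ((r%:C)%:A : M) (at level 2, format "r %:r").

Lemma invZ (k : R[i]) x : k != 0 -> invertible x -> invertible (k *: x).
Proof.
move=> k0 [y xy yx]; exists (k^-1 *: y); rewrite -scalerAl -scalerAr scalerA.
  by rewrite divff // scale1r.
by rewrite mulVf // scale1r.
Qed.

(** A two-sided inverse of x y gives a right inverse of x and, by commutation, a
    left inverse as well. *)
Lemma inv_commM x y : GRing.comm x y -> invertible (x * y) -> invertible x.
Proof.
move=> xy [z H1 H2]; exists (y * z); first by rewrite mulrA.
have zyx : z * y * x = 1 by rewrite -mulrA -xy.
by rewrite -[LHS]mul1r -{1}zyx -!mulrA (mulrA x y) (mulrA (x * y)) H1 mul1r mulrA.
Qed.

(** Same decomposition as in [sqrt_shift], with a Neumann series instead of a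
    root. *)
Lemma inv_pos_shift x e : pos x -> 0 < e -> invertible (x + e%:r).
Proof.
move=> [xa [t t0 xt]] e0; pose T := t + e; have T0 : 0 < T by rewrite /T; lra.
have -> : x + e%:r = T *:r (1 - T^-1 *:r (t%:r - x)).
  rewrite scalerBr scalerrA divff ?gt_eqF // scalerr1.
  by rewrite /T rscalarD opprB addrCA [t%:r + _]addrC addrK.
apply: invZ; first by rewrite fmorph_eq0 gt_eqF.
apply: neumann; apply: le_lt_trans (ler_nrmZr _ _) _; first by rewrite invr_ge0 ltW.
by rewrite mulrC ltr_pdivrMr // mul1r /T; lra.
Qed.

(** With q the inverse of p and d |q| < 1, p - d = p (1 - d q) is a product of
    commuting positive elements. *)
Lemma pos_inv_shift p : pos p -> invertible p -> exists2 d : R, 0 < d & pos (p - d%:r).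
Proof.
move=> pp [q pq qp]; have pa : adj p = p by case: pp.
have qa : adj q = q.
  have E : adj q * p = 1 by rewrite -{1}pa -adjM pq adj_one.
  by rewrite -[LHS]mulr1 -pq mulrA E mul1r.
(* the 1 is added so that no case distinction on q is needed *)
pose d := (nrm q + 1)^-1; have q0 := nrm_ge0 q.
have d0 : 0 < d by rewrite invr_gt0; lra.
exists d => //.
have -> : p - d%:r = p * (1%:r - d *:r q) by rewrite mulrBr mul_rscalar scalerr1 -scalerAr pq.
apply: posM_comm => //.
  apply: pos_realB; first by rewrite adjZr qa.
  apply: le_trans (ler_nrmZr _ (ltW d0)) _.
  by rewrite mulrC ler_pdivrMr ?mul1r; lra.
apply: commrB; first exact/commr_sym/comm_real.
by apply/commr_sym/bicommZ; rewrite /GRing.comm pq qp.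
Qed.

(** By [pos_inv_shift] the regularizing shift of [pos_sqrt_shift] can be taken from
    p itself. *)
Lemma pos_sqrt p : pos p -> invertible p ->
  exists s : M, [/\ adj s = s, s * s = p, bicomm p s & pos s].
Proof.
move=> pp ip; have [d d0 pd] := pos_inv_shift pp ip.
have [s [sa sE sB sp]] := pos_sqrt_shift pd d0.
exists s; split=> //; first by rewrite sE subrK.
move=> z pz; apply: sB; apply/commr_sym/commrB; first exact: commr_sym.
exact/commr_sym/comm_real.
Qed.

(** Invertibility off the positive half-line is turned into a norm bound without the
    spectral radius formula: the set of e >= 0 with x + e positive is closed, and at a positive
    infimum i the element x + i would be invertible, so that [pos_inv_shift] would
    produce a smaller member. *)
Lemma pos_of_inv x : adj x = x -> (forall e : R, 0 < e -> invertible (x + e%:r)) -> pos x.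
Proof.
move=> xa xinv.
pose E := [set e : R | 0 <= e /\ pos (x + e%:r)]%classic.
have Elb : has_lbound E by exists 0 => e [].
have E0 : E (nrm x).
  split; first exact: nrm_ge0.
  rewrite addrC -(opprK x); apply: pos_realB; first by rewrite adjN xa.
  by rewrite nrmN opprK.
have Einf : has_inf E by split=> //; exists (nrm x).
pose i := inf E.
have i0 : 0 <= i by apply: lb_le_inf; [exists (nrm x)|move=> e []].
have pi : pos (x + i%:r).
  apply: pos_shift_closed => d d0; have [e [_ pe] ei] := inf_adherent d0 Einf.
  have -> : x + i%:r + d%:r = x + e%:r + (i + d - e)%:r.
    by rewrite -!addrA -!rscalarD; congr (_ + _%:r); ring.
  by apply: posD => //; apply: pos_real; rewrite subr_ge0 ltW.
move: i0; rewrite le_eqVlt => /orP[/eqP i0|i0]; first by move: pi; rewrite -i0 scale0r addr0.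
have [d d0 pd] := pos_inv_shift pi (xinv _ i0).
have [id|di] := leP 0 (i - d).
  have /(ge_inf Elb) : E (i - d) by split=> //; rewrite rscalarB addrA.
  by rewrite -/i; lra.
have /(ge_inf Elb) : E 0.
  split=> //; have -> : x + 0%:r = (x + i%:r - d%:r) + (d - i)%:r; last first.
    by apply: posD => //; apply: pos_real; lra.
  by rewrite rscalarB scale0r addr0 addrA subrK addrK.
by rewrite -/i; lra.
Qed.

End PositivityInvertibility.

(** * Elements of the form x^* x *)

Section AdjointSquares.
Context {R : realType} {M : unitalCStarType R}.
Implicit Types (x y z p : M) (r s t e : R).

Notation "r *:r x" := (r%:C *: x : M) (at level 40).
Notation "r %:r" := ((r%:C)%:A : M) (at level 2, format "r %:r").

(** If z inverts k - x y, then (1 + y z x) / k inverts k - y x. *)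
Lemma inv_jacobson x y (k : R[i]) : k != 0 -> invertible (k%:A - x * y) ->
  invertible (k%:A - y * x).
Proof.
move=> k0 [z H1 H2].
have kc u : u * k%:A = k *: u :> M by rewrite -scalerAr mulr1.
have ck u : k%:A * u = k *: u :> M by rewrite -scalerAl mul1r.
have E1 : x * y * z = k *: z - 1 by rewrite -H1 mulrBl ck opprB addrC subrK.
have E2 : z * (x * y) = k *: z - 1 by rewrite -H2 mulrBr kc opprB addrC subrK.
exists (k^-1 *: (1 + y * z * x)).
  rewrite -scalerAr mulrDr mulr1 mulrBl ck.
  have -> : y * x * (y * z * x) = y * (x * y * z) * x by rewrite !mulrA.
  rewrite E1 mulrBr mulr1 mulrBl -scalerAr -scalerAl opprB [X in _ + X]addrCA subrr addr0.
  by rewrite subrK scalerA mulVf // scale1r.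
rewrite -scalerAl mulrDl mul1r mulrBr kc.
have -> : y * z * x * (y * x) = y * (z * (x * y)) * x by rewrite !mulrA.
rewrite E2 mulrBr mulr1 mulrBl -scalerAr -scalerAl opprB [X in _ + X]addrCA subrr addr0.
by rewrite subrK scalerA mulVf // scale1r.
Qed.

(** x^* x and x x^* have the same nonzero spectrum, hence the same
    nonnegative upper bounds. *)
Lemma pos_adjM_swap_le x t : 0 <= t -> pos (t%:r - adj x * x) -> pos (t%:r - x * adj x).
Proof.
move=> t0 pt; apply: pos_of_inv; first by rewrite adjB adj_real adjM adjK.
move=> e e0; have := inv_pos_shift pt e0.
rewrite [X in invertible X -> _]addrAC [X in _ -> invertible X]addrAC -!rscalarD.
by apply: inv_jacobson; rewrite fmorph_eq0; lra.
Qed.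

(** Twice this sum is (x + x^* )^2 + (i (x - x^* ))^2. *)
Lemma pos_adjM_sum x : pos (adj x * x + x * adj x).
Proof.
have s1 : adj (x + adj x) = x + adj x by rewrite adjD adjK addrC.
have s2 : adj ('i *: (x - adj x)) = 'i *: (x - adj x).
  rewrite adjZ adjB adjK -opprB scalerN -scaleNr; congr (_ *: _).
  by apply/eqP; rewrite eq_complex /= oppr0 opprK !eqxx.
have := posD (pos_sqr s1) (pos_sqr s2).
rewrite -scalerAl -scalerAr scalerA.
have -> : 'i * 'i = -1 :> R[i] by rewrite -expr2 sqr_i.
rewrite scaleN1r !mulrDl !mulrDr !mulrN !mulNr opprK.
set p := x * x; set q := adj x * adj x; set u := adj x * x; set v := x * adj x.
have -> : p + v + (u + q) - (p - v + (- u + q)) = 2 *:r (u + v).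
  rewrite rmorphD rmorph1 scalerDl scale1r !opprD !opprK.
  rewrite addrACA (addrACA p) subrr add0r (addrACA u) subrr addr0.
  by rewrite addrC addrACA.
have h : 0 <= 2^-1 :> R by lra.
move=> /(posZ h).
by rewrite scalerrA mulVf ?scalerr1.
Qed.

(** Kaplansky's argument multiplies x by a root f of the negative part of
    h = x^* x.  Here the absolute value of h is regularized to k with
    k^2 = h^2 + n^2, and f is a root of D = k - h, so that b = x f has
    b^* b = h D <= n^2 (for n = 0 this would be h D <= 0).  Then
    b b^* <= n^2 as well, and since b^* b + b b^* >= 0 this bounds b^* b from
    below: |h D| <= n^2.  As D^2 = n^2 - 2 h D, the distance of h to the positive
    k is at most 2 n. *)
Lemma pos_adjM x : pos (adj x * x).
Proof.
pose h := adj x * x; rewrite -/h.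
have ha : adj h = h by rewrite adjM adjK.
apply: pos_closed => e e0.
pose n := e / 2; have n0 : 0 < n by rewrite /n; lra.
have n20 : 0 < n ^+ 2 by rewrite exprn_gt0.
have hh := pos_sqr ha.
have [k [ka kE kB pk]] := pos_sqrt (posD hh (pos_real (ltW n20))) (inv_pos_shift hh n20).
have kh : GRing.comm k h.
  by apply: kB; apply/commr_sym/commrD; [apply: commrM|exact/commr_sym/comm_real].
have hr r : GRing.comm h (k + r%:r).
  by apply: commrD; [exact: commr_sym|exact/commr_sym/comm_real].
pose D := k - h.
have Da : adj D = D by rewrite adjB ka ha.
(* (D + r) (k + r + h) = (k + r)^2 - h^2 = 2 r k + r^2 + n^2 *)
have Dinv r : 0 <= r -> invertible (D + r%:r).
  move=> r0; have Kh : GRing.comm (k + r%:r) h by exact/commr_sym/hr.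
  have -> : D + r%:r = k + r%:r - h by rewrite addrAC.
  apply: (inv_commM (y := k + r%:r + h)); first exact: comm_sub_add.
  rewrite comm_subsqr //.
  rewrite mulrDl !mulrDr kE mul_rscalar !rscalar_mul.
  have -> : h * h + (n ^+ 2)%:r + r *:r k + (r *:r k + r *:r r%:r) - h * h =
      ((r *:r k + r *:r k) + (r ^+ 2)%:r) + (n ^+ 2)%:r.
    rewrite -!(addrA (h * h)) addrC subrK scalerrA -expr2.
    by rewrite -addrA addrC addrA.
  have pkk := posZ r0 pk.
  by apply: inv_pos_shift => //; apply: posD (posD pkk pkk) (pos_real (sqr_ge0 r)).
have pD : pos D by apply: pos_of_inv => // r /ltW /Dinv.
have iD : invertible D by have := Dinv 0 (lexx 0); rewrite scale0r addr0.
have [f [fa fE fB _]] := pos_sqrt pD iD.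
have Dh : GRing.comm D h by apply/commr_sym/commrB => //; exact: commr_sym.
have Dk : GRing.comm D k by apply/commr_sym/commrB.
have fh : GRing.comm f h by exact: fB.
have bE : adj (x * f) * (x * f) = h * D.
  by rewrite adjM fa -mulrA (mulrA (adj x)) -/h mulrA fh -mulrA fE.
(* D (k + h) = k^2 - h^2 = n^2; so n^2 - h D is a product of positive elements *)
have nE : D * k = (n ^+ 2)%:r - h * D.
  have : D * (k + h) = (n ^+ 2)%:r by rewrite comm_subsqr // kE addrAC subrr add0r.
  by rewrite mulrDr Dh => <-; rewrite addrK.
have p1 : pos ((n ^+ 2)%:r - adj (x * f) * (x * f)).
  by rewrite bE -nE; apply: posM_comm.
have p2 : pos ((n ^+ 2)%:r + adj (x * f) * (x * f)).
  have := posD (pos_adjM_sum (x * f)) (pos_adjM_swap_le (ltW n20) p1).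
  by rewrite addrACA subrr addr0 addrC.
have hD : nrm (h * D) <= n ^+ 2 by rewrite -bE; apply: nrm_le_of_pos => //; rewrite ltW.
have DD : D * D = (n ^+ 2)%:r - h * D - h * D by rewrite -nE -Dh -mulrBr.
exists k => //; rewrite nrmBC -/D.
have : nrm D ^+ 2 <= n ^+ 2 + n ^+ 2 + n ^+ 2.
  rewrite -nrm_sqr // DD; have := ler_nrmD ((n ^+ 2)%:r - h * D) (- (h * D)).
  have := ler_nrmD (n ^+ 2)%:r (- (h * D)); rewrite nrmN.
  have := nrm_real_le (M := M) (ltW n20); lra.
have := nrm_ge0 D; have -> : e = 2 * n by rewrite /n; field.
by nra.
Qed.

Lemma pos_congr x z : pos x -> pos (adj z * x * z).
Proof.
move=> px; apply: pos_closed => d d0; have z0 := sqr_ge0 (nrm z).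
pose e := d / (nrm z ^+ 2 + 1); have e0 : 0 < e by rewrite divr_gt0 //; lra.
have [s [sa sE _ _]] := pos_sqrt_shift px e0.
exists (adj (s * z) * (s * z)); first exact: pos_adjM.
have -> : adj (s * z) * (s * z) = adj z * (x + e%:r) * z by rewrite adjM sa -sE !mulrA.
rewrite -mulrBl -mulrBr opprD addrA subrr add0r mulrN mulNr nrmN mul_rscalar.
rewrite -scalerAl; apply: le_trans (ler_nrmZr _ (ltW e0)) _.
by rewrite nrm_adjM /e mulrAC ler_pdivrMr; nra.
Qed.

End AdjointSquares.

(** * Spectrum and 2 x 2 blocks *)

Section SpectrumAndBlocks.
Context {R : realType} {M : unitalCStarType R}.
Implicit Types (a b c d p q x : M) (r s t : R).

Notation "r *:r x" := (r%:C *: x : M) (at level 40).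
Notation "r %:r" := ((r%:C)%:A : M) (at level 2, format "r %:r").

(** For k = a + i b with b <> 0, (x - k) (x - conj k) = (x - a)^2 + b^2 is a positive
    element plus a positive number; for k < 0 so is x - k. *)
Lemma inv_resolvent x (k : R[i]) : pos x -> k != 0 -> ~~ (0 <= k) -> invertible (1 - k^-1 *: x).
Proof.
move=> px k0 kneg; have xa : adj x = x by case: px.
suff : invertible (x - k%:A).
  have kN : - k^-1 != 0 by rewrite oppr_eq0 invr_eq0.
  move=> /(invZ kN); rewrite scalerBr scalerA mulNr mulVf // !scaleNr scale1r opprK.
  by rewrite addrC.
case: k k0 kneg => a b k0; rewrite lecE /= => kneg.
have [b0|b0] := eqVneq b 0.
  move: kneg; rewrite b0 eqxx /= -ltNge => a0.
  have -> : x - (a +i* 0)%:A = x + (- a)%:r by rewrite rmorphN scaleNr.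
  by apply: inv_pos_shift => //; lra.
pose y := x - a%:r; have ya : adj y = y by rewrite adjB adj_real xa.
have kE : x - (a +i* b)%:A = y - 'i *: b%:r.
  rewrite /y -addrA -opprD scalerA -scalerDl; congr (_ - _ *: _).
  by rewrite [LHS]complexE.
rewrite kE; apply: (inv_commM (y := y + 'i *: b%:r)).
  apply: comm_sub_add; rewrite /GRing.comm -scalerAl -scalerAr; congr (_ *: _).
  exact/commr_sym/comm_real.
rewrite comm_subsqr; last first.
  rewrite /GRing.comm -scalerAl -scalerAr; congr (_ *: _); exact/commr_sym/comm_real.
have -> : 'i *: b%:r * ('i *: b%:r) = - (b ^+ 2)%:r.
  rewrite -scalerAl -scalerAr scalerA; have -> : 'i * 'i = -1 :> R[i] by rewrite -expr2 sqr_i.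
  by rewrite scaleN1r rscalar_mul scalerrA -expr2.
rewrite opprK; apply: inv_pos_shift; first exact: pos_sqr.
by rewrite exprn_even_gt0.
Qed.

(** The sum is (d^* p + q)^* (d^* p + q) + p (1 - d d^* ) p. *)
Lemma pos_block_of_contraction p q d : adj p = p -> adj q = q -> nrm d <= 1 ->
  pos (p * p + q * q + p * d * q + adj (p * d * q)).
Proof.
move=> pa qa d1; pose z := adj d * p + q.
have dd : nrm (d * adj d) <= 1.
  by rewrite -{1}(adjK d) nrm_adjM nrm_adj expr_le1 // nrm_ge0.
have p1 : pos (adj p * (1%:r - d * adj d) * p).
  by apply/pos_congr/pos_realB => //; rewrite adjM adjK.
have := posD (pos_adjM z) p1; congr pos.
rewrite /z adjD !adjM adjK pa qa scalerr1 mulrBr mulrBl mulr1 mulrDl !mulrDr !mulrA.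
rewrite addrC -!addrA; congr (_ + _); rewrite !addrA addNr add0r.
by rewrite -addrA [LHS]addrC [q * adj d * p + _]addrC addrAC.
Qed.

(** With s > |b| and t = 1 / s, c b c^* <= s c c^* leaves a - c c^* / s >= 0; then
    s tends to |b|. *)
Lemma nrm_of_pos_block a b c : pos a -> pos b ->
    (forall t : R, 0 <= t ->
      pos (a + t ^+ 2 *:r (c * b * adj c) - (2 * t) *:r (c * adj c))) ->
  nrm c ^+ 2 <= nrm a * nrm b.
Proof.
move=> pa pb H; have a0 := nrm_ge0 a; have b0 := nrm_ge0 b.
apply/ler_addgt0Pr => e e0.
pose s := nrm b + e / (nrm a + 1).
have s1 : 0 < e / (nrm a + 1) by rewrite divr_gt0 //; lra.
have s0 : 0 < s by rewrite /s; lra.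
have t0 : 0 < s^-1 by rewrite invr_gt0.
have p1 : pos (s%:r - b) by apply: pos_realB; [case: pb|rewrite /s; lra].
have p2 := posZ (sqr_ge0 s^-1) (pos_congr (adj c) p1).
have : pos (a - s^-1 *:r (c * adj c)).
  have := posD (H _ (ltW t0)) p2; congr pos.
  rewrite adjK mulrBr mulrBl scalerBr mul_rscalar -scalerAl scalerrA.
  have -> : s^-1 ^+ 2 * s = s^-1 by field; rewrite gt_eqF.
  have -> : (2 * s^-1) *:r (c * adj c) = s^-1 *:r (c * adj c) + s^-1 *:r (c * adj c).
    by rewrite -scalerDl -rmorphD -mulr2n mulr_natl.
  by rewrite opprD !addrA subrK addrAC addrK.
have pcc : pos (s^-1 *:r (c * adj c)).
  by apply: posZ (ltW t0) _; have := pos_adjM (adj c); rewrite adjK.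
move=> /(ler_nrm_pos pcc) H1.
have : nrm c ^+ 2 <= s * nrm a.
  rewrite -nrm_adj -nrm_adjM adjK.
  have {1}-> : c * adj c = s *:r (s^-1 *:r (c * adj c)).
    by rewrite scalerrA divff ?gt_eqF // scalerr1.
  by apply: le_trans (ler_nrmZr _ (ltW s0)) _; rewrite ler_pM2l.
move=> /le_trans; apply; rewrite /s mulrDl mulrC lerD2l mulrAC ler_pdivrMr; nra.
Qed.

End SpectrumAndBlocks.

(** * Real-valued norms and completeness *)

Section RealNorm.
Context {R : realType}.

Lemma normcE (k : R[i]) : `|k| = (normc k)%:C.
Proof. by []. Qed.

Lemma normc_ge0 (k : R[i]) : 0 <= normc k.
Proof. by rewrite -ler0c -normcE. Qed.

Lemma normcC (k : R[i]) : normc (conjc k) = normc k.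
Proof. by case: k => a b; rewrite /normc /= sqrrN. Qed.

Lemma ler_Re_normc (k : R[i]) : `|complex.Re k| <= normc k.
Proof.
by case: k => a b /=; rewrite -sqrtr_sqr ler_wsqrtr // lerDl sqr_ge0.
Qed.

Lemma ler_Im_normc (k : R[i]) : `|complex.Im k| <= normc k.
Proof.
by case: k => a b /=; rewrite -sqrtr_sqr ler_wsqrtr // lerDr sqr_ge0.
Qed.

Lemma normc_le_ReIm (k : R[i]) : normc k <= `|complex.Re k| + `|complex.Im k|.
Proof.
case: k => a b /=; have s0 := addr_ge0 (normr_ge0 a) (normr_ge0 b).
rewrite -[leRHS](ger0_norm s0) -sqrtr_sqr ler_wsqrtr // sqrrD !real_normK ?num_real //.
by rewrite addrAC lerDl mulrn_wge0 // mulr_ge0.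
Qed.

Definition rnorm (V : normedModType R[i]) (x : V) : R := complex.Re `|x|.

Context {V : normedModType R[i]}.
Implicit Types x y : V.

Lemma rnormE x : `|x| = (rnorm x)%:C.
Proof. by rewrite /rnorm RRe_real // ger0_real. Qed.

Lemma rnorm_ge0 x : 0 <= rnorm x.
Proof. by rewrite -ler0c -rnormE. Qed.

Lemma ler_rnormD x y : rnorm (x + y) <= rnorm x + rnorm y.
Proof. by rewrite -lecR rmorphD /= -!rnormE ler_normD. Qed.

Lemma rnormZ k x : rnorm (k *: x) = normc k * rnorm x.
Proof. by apply: (@complexI R); rewrite rmorphM /= -!rnormE normrZ normcE. Qed.

Lemma rnormN x : rnorm (- x) = rnorm x.
Proof. by rewrite /rnorm normrN. Qed.

Lemma rnorm_eq0 x : rnorm x = 0 -> x = 0.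
Proof. by move=> x0; apply/eqP; rewrite -normr_eq0 rnormE x0. Qed.

End RealNorm.

(** Completeness in terms of sequences, which is how it enters the abstract
    unital algebras. *)
Lemma complete_seq (F : numFieldType) (V : completeNormedModType F) (u : nat -> V) :
    (forall e, 0 < e -> exists N : nat, forall m n : nat,
      (N <= m)%N -> (N <= n)%N -> `|u m - u n| < e) ->
  exists l, forall e, 0 < e -> exists N : nat, forall n : nat,
    (N <= n)%N -> `|u n - l| < e.
Proof.
move=> Cu; have : cvg (u @ \oo)%classic.
  apply/cauchy_cvgP/cauchy_exP => e /Cu[N HN]; exists (u N); exists N => // n /= Nn.
  by rewrite -ball_normE /=; exact: HN.
move=> /cvgrPdist_lt ul; exists (lim (u @ \oo)%classic) => e e0.
have [N _ HN] := ul e e0; exists N => n Nn; rewrite distrC; exact: HN.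
Qed.

Section CStarAlgebraTheory.
Context {R : realType} {A : cstarAlgType R}.
Implicit Types a b c : A.

Lemma amul0l a : amul 0 a = 0.
Proof. by rewrite -(scale0r (0 : A)) amulZl !scale0r. Qed.

Lemma amul0r a : amul a 0 = 0.
Proof. by rewrite -(scale0r (0 : A)) amulZr !scale0r. Qed.

Lemma star0 : star (0 : A) = 0.
Proof. by rewrite -(scale0r (0 : A)) starZ rmorph0 !scale0r. Qed.

Lemma conjE (k : R[i]) : Num.conj k = conjc k.
Proof. by []. Qed.

Lemma starZr (r : R) a : star (r%:C *: a) = r%:C *: star a.
Proof. by rewrite starZ conjE conjc_real. Qed.

Lemma ler_rnormM a b : rnorm (amul a b) <= rnorm a * rnorm b.
Proof. by rewrite -lecR rmorphM /= -!rnormE normr_amul. Qed.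

Lemma rnorm_cstar a : rnorm (amul (star a) a) = rnorm a ^+ 2.
Proof. by apply: (@complexI R); rewrite rmorphXn /= -!rnormE normr_cstar. Qed.

Lemma rnorm_star a : rnorm (star a) = rnorm a.
Proof.
have H b : rnorm b <= rnorm (star b).
  have := ler_rnormM (star b) b; rewrite rnorm_cstar.
  have := rnorm_ge0 b; have := rnorm_ge0 (star b); nra.
by apply/eqP; rewrite eq_le H andbT -{2}(starK a) H.
Qed.

End CStarAlgebraTheory.

(** * The unitization of a C*-algebra *)

Definition unitization (R : realType) (A : cstarAlgType R) : Type := (A * R[i])%type.

Section Unitization.
Context {R : realType} {A : cstarAlgType R}.
Notation U := (unitization A).
Implicit Types (u v w : U) (a b x : A).

HB.instance Definition _ := GRing.Lmodule.copy U (A * (R[i])^o)%type.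

Definition uone : U := (0, 1).
Definition umul u v : U := (amul u.1 v.1 + u.2 *: v.1 + v.2 *: u.1, u.2 * v.2).

Fact umulA : associative umul.
Proof.
move=> [a k] [b l] [c m]; rewrite /umul /=; congr (_, _); last by rewrite mulrA.
rewrite !amulDl !amulDr !amulA !amulZl !amulZr !scalerDr !scalerA.
rewrite (mulrC m k) (mulrC m l) -!addrA; congr (_ + _).
rewrite [RHS]addrCA; congr (_ + _); rewrite addrCA; congr (_ + _); exact: addrCA.
Qed.

Fact umul1 : left_id uone umul.
Proof.
move=> [a k]; rewrite /umul /= amul0l add0r scale1r scaler0 addr0 mul1r //.
Qed.

Fact umulr1 : right_id uone umul.
Proof. by move=> [a k]; rewrite /umul /= amul0r add0r scale1r scaler0 add0r mulr1. Qed.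

Fact umulDl : left_distributive umul +%R.
Proof.
move=> [a k] [b l] [c m]; rewrite /umul /=; congr (_, _); last exact: mulrDl.
by rewrite amulDl scalerDl scalerDr (addrACA (amul a c)) (addrACA (amul a c + _)).
Qed.

Fact umulDr : right_distributive umul +%R.
Proof.
move=> [a k] [b l] [c m]; rewrite /umul /=; congr (_, _); last exact: mulrDr.
by rewrite amulDr scalerDl scalerDr (addrACA (amul a b)) (addrACA (amul a b + _)).
Qed.

Fact uone_neq0 : uone != 0.
Proof. by apply/eqP => -[] /eqP; rewrite oner_eq0. Qed.

HB.instance Definition _ :=
  GRing.Zmodule_isNzRing.Build U umulA umul1 umulr1 umulDl umulDr uone_neq0.

Fact uscalerAl (k : R[i]) u v : k *: (u * v) = (k *: u) * v.
Proof.
case: u v => [a l] [b m]; rewrite /GRing.mul /= /umul /=; congr (_, _); last exact: mulrA.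
by rewrite amulZl !scalerDr !scalerA (mulrC m).
Qed.

HB.instance Definition _ := GRing.Lmodule_isLalgebra.Build R[i] U uscalerAl.

Fact uscalerAr (k : R[i]) u v : k *: (u * v) = u * (k *: v).
Proof.
case: u v => [a l] [b m]; rewrite /GRing.mul /= /umul /=; congr (_, _); last exact: mulrCA.
by rewrite amulZr !scalerDr !scalerA (mulrC l).
Qed.

HB.instance Definition _ := GRing.Lalgebra_isAlgebra.Build R[i] U uscalerAr.

Definition uadj u : U := (star u.1, conjc u.2).

(** The unitization acts on the algebra, which is an ideal of it. *)
Definition uact u x : A := amul u.1 x + u.2 *: x.

Lemma uactM u v x : uact (u * v) x = uact u (uact v x).
Proof.
case: u v => [a k] [b l]; rewrite /uact /GRing.mul /=.
rewrite !amulDl !amulDr !amulZl !amulZr amulA scalerDr scalerA -!addrA; congr (_ + _).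
exact: addrCA.
Qed.

Lemma uactD u v x : uact (u + v) x = uact u x + uact v x.
Proof. by rewrite /uact /= amulDl scalerDl addrACA. Qed.

Lemma uactZ (k : R[i]) u x : uact (k *: u) x = k *: uact u x.
Proof. by rewrite /uact /= amulZl scalerDr scalerA. Qed.

Lemma uact_adj u x y : amul (star (uact u x)) y = amul (star x) (uact (uadj u) y).
Proof.
by rewrite /uact /uadj /= starD starM starZ amulDl amulDr amulA amulZl amulZr.
Qed.

(** The bound on the scalar part keeps the norm definite when A already has a
    unit: then (a, k) can act as zero without being zero. *)
Definition ubound u (r : R) : Prop :=
  [/\ 0 <= r, normc u.2 <= r & forall x, rnorm (uact u x) <= r * rnorm x].

Definition unorm u : R := inf [set r | ubound u r]%classic.

Lemma ubound_pair u : ubound u (rnorm u.1 + normc u.2).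
Proof.
split; rewrite ?addr_ge0 ?rnorm_ge0 ?normc_ge0 // ?lerDr ?rnorm_ge0 // => x.
apply: le_trans (ler_rnormD _ _) _.
by rewrite rnormZ mulrDl lerD2r ler_rnormM.
Qed.

Lemma ubound_lb u : has_lbound [set r | ubound u r]%classic.
Proof. by exists 0 => r []. Qed.

Lemma unorm_le u r : ubound u r -> unorm u <= r.
Proof. by move=> ur; apply: ge_inf => //; exact: ubound_lb. Qed.

(** The infimum is attained: the conditions are closed in r. *)
Lemma ubound_unorm u : ubound u (unorm u).
Proof.
have H0 : ([set r | ubound u r] !=set0)%classic.
  by exists (rnorm u.1 + normc u.2); exact: ubound_pair.
split; [by apply: lb_le_inf => // r []|by apply: lb_le_inf => // r []|move=> x].
have x0 := rnorm_ge0 x; apply/ler_addgt0Pr => e e0.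
have d0 : 0 < e / (rnorm x + 1) by rewrite divr_gt0 //; lra.
have [r [_ _ /(_ x) ur] rlt] := inf_adherent d0 (conj H0 (ubound_lb u)).
apply: le_trans ur _; apply: le_trans (ler_wpM2r x0 (ltW rlt)) _.
rewrite mulrDl lerD2l mulrAC ler_pdivrMr; nra.
Qed.

Lemma rnorm_uact u x : rnorm (uact u x) <= unorm u * rnorm x.
Proof. by have [_ _] := ubound_unorm u. Qed.

Lemma normc_snd u : normc u.2 <= unorm u.
Proof. by have [] := ubound_unorm u. Qed.

Fact unorm_ge0 u : 0 <= unorm u.
Proof. by have [] := ubound_unorm u. Qed.

(** Applied to a^*, the element (a, k) yields a a^* + k a^*.  Hence |a| is at
    most the sum of the norm of (a, k) and of |k|, which makes completeness of the
    unitization that of its two factors. *)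
Lemma rnorm_fst u : rnorm u.1 <= 2 * unorm u.
Proof.
case: (lerP (rnorm u.1) 0) => [|u0].
  by have := unorm_ge0 u; lra.
have := rnorm_uact u (star u.1); have := normc_snd u.
have := ler_rnormD (uact u (star u.1)) (- (u.2 *: star u.1)).
have := rnorm_cstar (star u.1).
rewrite starK /uact addrK rnormN rnormZ rnorm_star => ->.
set N := unorm u; set r := rnorm u.1 in u0 *; nra.
Qed.

Fact uadjK u : uadj (uadj u) = u.
Proof. by case: u => a k; rewrite /uadj /= starK conjcK. Qed.

Fact uadjD u v : uadj (u + v) = uadj u + uadj v.
Proof. by rewrite /uadj /= starD rmorphD. Qed.

Fact uadjZ (k : R[i]) u : uadj (k *: u) = conjc k *: uadj u.
Proof. by rewrite /uadj /= starZ rmorphM. Qed.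

Fact uadjM u v : uadj (u * v) = uadj v * uadj u.
Proof.
rewrite /uadj /GRing.mul /= /umul /= !starD starM !starZ rmorphM /= mulrC.
by rewrite -!addrA; congr (_ + _, _); rewrite addrC.
Qed.

Fact unorm_eq0 u : unorm u = 0 -> u = 0.
Proof.
move=> u0; have := rnorm_fst u; have := normc_snd u.
rewrite u0 mulr0 => h1 h2; case: u h1 h2 {u0} => a k /= h1 h2; congr (_, _).
  by apply: rnorm_eq0; apply/eqP; rewrite eq_le h2 rnorm_ge0.
by apply: ComplexField.Normc.eq0_normc; apply/eqP; rewrite eq_le h1 normc_ge0.
Qed.

Fact ler_unormD u v : unorm (u + v) <= unorm u + unorm v.
Proof.
have [u0 u1 u2] := ubound_unorm u; have [v0 v1 v2] := ubound_unorm v.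
apply: unorm_le; split=> [||x]; first exact: addr_ge0.
  exact: le_trans (le_normcD _ _) (lerD u1 v1).
by rewrite uactD mulrDl; apply: le_trans (ler_rnormD _ _) (lerD _ _).
Qed.

Fact ler_unormZ (k : R[i]) u : unorm (k *: u) <= normc k * unorm u.
Proof.
have [u0 u1 u2] := ubound_unorm u; have k0 := normc_ge0 k.
apply: unorm_le; split=> [||x]; first exact: mulr_ge0.
  by rewrite ComplexField.Normc.normcM ler_wpM2l.
by rewrite uactZ rnormZ -mulrA ler_wpM2l.
Qed.

Fact ler_unormM u v : unorm (u * v) <= unorm u * unorm v.
Proof.
have [u0 u1 u2] := ubound_unorm u; have [v0 v1 v2] := ubound_unorm v.
apply: unorm_le; split=> [||x]; first exact: mulr_ge0.
  by rewrite ComplexField.Normc.normcM ler_pM ?normc_ge0.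
by rewrite uactM -mulrA; apply: le_trans (u2 _) _; rewrite ler_wpM2l.
Qed.

(** For the operator part, |u x|^2 = |x^* (u^* u x)|. *)
Fact ler_unorm_cstar u : unorm u ^+ 2 <= unorm (uadj u * u).
Proof.
have [n0 n1 n2] := ubound_unorm (uadj u * u).
rewrite -[leRHS]sqr_sqrtr // ler_sqr ?nnegrE ?unorm_ge0 ?sqrtr_ge0 //.
apply: unorm_le; split=> [||x]; first exact: sqrtr_ge0.
  rewrite -ler_sqr ?nnegrE ?normc_ge0 ?sqrtr_ge0 // sqr_sqrtr //.
  by move: n1; rewrite ComplexField.Normc.normcM normcC expr2.
rewrite -ler_sqr ?nnegrE ?mulr_ge0 ?rnorm_ge0 ?sqrtr_ge0 // exprMn sqr_sqrtr //.
rewrite -rnorm_cstar uact_adj -uactM.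
have := n2 x; have := ler_rnormM (star x) (uact (uadj u * u) x).
rewrite rnorm_star; have := rnorm_ge0 x; nra.
Qed.

Fact unorm_complete (s : nat -> U) :
    (forall e, 0 < e -> exists N : nat, forall m n : nat,
       (N <= m)%N -> (N <= n)%N -> unorm (s m - s n) < e) ->
    exists l, forall e, 0 < e -> exists N : nat, forall n : nat,
       (N <= n)%N -> unorm (s n - l) < e.
Proof.
move=> Cs.
have Reof (e : R[i]) : 0 < e -> 0 < complex.Re e /\ e = (complex.Re e)%:C.
  by case: e => x y; rewrite ltcE /= => /andP[/eqP -> ->].
have [a Ha] : exists a, forall e : R[i], 0 < e -> exists N : nat, forall n : nat,
    (N <= n)%N -> `|(s n).1 - a| < e.
  apply: complete_seq => e /Reof[e0 ->].
  have [N HN] := Cs _ (divr_gt0 e0 (ltr0n _ 2)); exists N => m n Nm Nn.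
  rewrite rnormE ltcR; have := rnorm_fst (s m - s n); have := HN _ _ Nm Nn => /=; lra.
have Hc (f : R[i] -> R) : (forall k l, `|f k - f l| <= normc (k - l)) ->
    exists t, forall e : R, 0 < e -> exists N : nat, forall n : nat,
    (N <= n)%N -> `|f (s n).2 - t| < e.
  move=> fl; apply: (@complete_seq _ R^o (fun n => f (s n).2)) => e /Cs[N HN].
  exists N => m n Nm Nn; apply: le_lt_trans (fl _ _) _.
  by apply: le_lt_trans (HN _ _ Nm Nn); exact: normc_snd (s m - s n).
have [|p Hp] := Hc (@complex.Re R).
  by move=> [a1 b1] [a2 b2]; exact: (ler_Re_normc ((a1 +i* b1) - (a2 +i* b2))).
have [|q Hq] := Hc (@complex.Im R).
  by move=> [a1 b1] [a2 b2]; exact: (ler_Im_normc ((a1 +i* b1) - (a2 +i* b2))).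
exists (a, p +i* q) => e e0; have e3 : 0 < e / 3 by lra.
have [|N1 H1] := Ha (e / 3)%:C; first by rewrite ltcR.
have [N2 H2] := Hp _ e3; have [N3 H3] := Hq _ e3.
exists (maxn N1 (maxn N2 N3)) => n; rewrite !geq_max => /andP[/H1 h1 /andP[/H2 h2 /H3 h3]].
apply: le_lt_trans (unorm_le (ubound_pair _)) _ => /=.
move: h1; rewrite rnormE ltcR => h1.
suff : normc ((s n).2 - (p +i* q)) <= `|complex.Re (s n).2 - p| + `|complex.Im (s n).2 - q| by lra.
by case: (s n).2 => x y; exact: (normc_le_ReIm ((x +i* y) - (p +i* q))).
Qed.

HB.instance Definition _ := isUnitalCStar.Build R U uadjK uadjD uadjZ uadjM
  unorm_ge0 unorm_eq0 ler_unormD ler_unormZ ler_unormM ler_unorm_cstar unorm_complete.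

End Unitization.

(** * Positive elements of a C*-algebra inside its unitization *)

Section Embedding.
Context {R : realType} {A : cstarAlgType R}.
Notation U := (unitization A).
Implicit Types (u v : U) (a b c x y : A).

Definition uinj a : U := (a, 0).

Lemma uinjD a b : uinj (a + b) = uinj a + uinj b.
Proof. by congr (_, _); rewrite /= addr0. Qed.

Lemma uinjZ (k : R[i]) a : uinj (k *: a) = k *: uinj a.
Proof. by congr (_, _); rewrite /= scaler0. Qed.

Lemma uinjN a : uinj (- a) = - uinj a.
Proof. by rewrite -scaleN1r uinjZ scaleN1r. Qed.

Lemma uinjM a b : uinj (amul a b) = uinj a * uinj b.
Proof. by congr (_, _); rewrite /= ?mulr0 // !scale0r !addr0. Qed.

Lemma adj_uinj a : adj (uinj a) = uinj (star a).
Proof. by congr (_, _); rewrite /= oppr0. Qed.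

Lemma mul_uinj u x : u * uinj x = uinj (uact u x).
Proof. by congr (_, _); rewrite /= ?mulr0 // scale0r addr0. Qed.

Lemma uinj_inj : injective uinj.
Proof. by move=> a b []. Qed.

Lemma nrm_uinj a : nrm (uinj a) = rnorm a.
Proof.
apply/eqP; rewrite eq_le; apply/andP; split.
  apply: le_trans (unorm_le (ubound_pair _)) _.
  by rewrite [normc _]ComplexField.Normc.normc0 addr0.
case: (lerP (rnorm a) 0) => [|a0]; first by move/le_trans; apply; exact: nrm_ge0.
have := rnorm_uact (uinj a) (star a); rewrite /uact scale0r addr0 /=.
have := rnorm_cstar (star a); rewrite starK rnorm_star => ->.
by rewrite expr2 ler_pM2r.
Qed.

(** (1 - a) (1 - b) = 1 - (a + b - a b), and every inverse of 1 - a has scalar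
    part 1. *)
Lemma inv_quasi a : invertible (1 - uinj a) <-> quasi_invertible a.
Proof.
have E b c : (1 - uinj b) * (1 - uinj c) = 1 - uinj (b + c - amul b c).
  rewrite mulrBl mul1r mulrBr mulr1 -uinjM !uinjD uinjN.
  by rewrite opprB !opprD opprK -addrA; congr (_ + _); rewrite addrA [LHS]addrC addrA.
split=> [[[c m] H1 H2]|[b [H1 H2]]].
  have m1 : m = 1 by move: H1 => /(congr1 snd) /=; rewrite oppr0 addr0 mul1r.
  have cE : (c, m) = 1 - uinj (- c) :> U.
    by rewrite m1; congr (_, _); rewrite /= ?opprK ?add0r // oppr0 addr0.
  have kill b : 1 - uinj b = 1 -> b = 0.
    by move=> /(congr1 fst) /=; rewrite add0r => /eqP; rewrite oppr_eq0 => /eqP.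
  move: H1 H2; rewrite cE !E => /kill H1 /kill H2; exists (- c); split=> //.
  by rewrite [a + _]addrC.
have uinj0 : uinj 0 = 0 by [].
by exists (1 - uinj b); rewrite E ?H1 ?(addrC b) ?H2 uinj0 subr0.
Qed.

(** [pos_of_inv] needs invertibility at the points - e only, and [inv_resolvent]
    gives it at every k off the half-line; [inv_quasi] translates both. *)
Lemma cposE a : cpos a <-> pos (uinj a).
Proof.
split=> [[sa Ha]|pa].
  apply: pos_of_inv => [|e e0]; first by rewrite adj_uinj sa.
  have : quasi_invertible ((- e%:C)^-1 *: a).
    apply: contrapT => nq; have := Ha (- e%:C) (or_intror nq).
    by rewrite oppr_ge0 lecR leNgt e0.
  have e1 : e%:C != 0 by rewrite fmorph_eq0 gt_eqF.
  move=> /inv_quasi /(invZ e1); congr invertible.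
  by rewrite scalerBr uinjZ scalerA invrN mulrN divff // scaleN1r opprK addrC.
split=> [|k [->//|nq]].
  by case: pa; rewrite adj_uinj => /uinj_inj.
have [->//|k0] := eqVneq k 0.
apply: contrapT => /negP kneg; apply: nq; apply/inv_quasi.
by rewrite uinjZ; exact: inv_resolvent.
Qed.

(** The inverse roots x and y of a + e/2 and b + e/2 are elements of the
    unitization, but x w and y z are in A for w and z in A.  So the hypothesis is
    available for these, and it suffices to bound x c y as an operator on A. *)
Lemma pos_of_form_bound a b c : cpos a -> cpos b ->
    (forall x y, rnorm (amul (amul (star x) c) y) ^+ 2 <=
       rnorm (amul (amul (star x) a) x) * rnorm (amul (amul (star y) b) y)) ->
  cpos (a + b + c + star c).
Proof.
move=> /cposE pa /cposE pb H; apply/cposE; apply: pos_shift_closed => e e0.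
have e20 : 0 < e / 2 by lra.
have root a' : pos (uinj a') -> exists p x : U,
    [/\ adj p = p, p * p = uinj a' + (e/2)%:C%:A, adj x = x, x * p = 1 /\ p * x = 1 &
     forall w, rnorm (amul (amul (star (uact x w)) a') (uact x w)) <= rnorm w ^+ 2].
  move=> pa'; have [p [p_a pE pB pp]] := pos_sqrt_shift pa' e20.
  have [x px xp] : invertible p.
    by apply: (@inv_commM _ _ p p) => //; rewrite pE; exact: inv_pos_shift.
  have xa : adj x = x.
    have E : adj x * p = 1 by rewrite -{1}p_a -adjM px adj_one.
    by rewrite -[LHS]mulr1 -px mulrA E mul1r.
  exists p, x; split=> // w.
  rewrite -nrm_uinj !uinjM -adj_uinj -!mul_uinj adjM xa.
  have -> : adj (uinj w) * x * uinj a' * (x * uinj w) =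
      adj (uinj w) * (x * uinj a' * x) * uinj w by rewrite !mulrA.
  (* x a' x = 1 - (e / 2) x^2 *)
  have x1 : nrm (x * uinj a' * x) <= 1.
    apply: le_trans (nrm1_le1 (M := U)); apply: ler_nrm_pos.
      by rewrite -{1}xa; exact: pos_congr.
    have -> : 1 - x * uinj a' * x = adj x * (e / 2)%:C%:A * x.
      have E1 : x * (p * p) * x = 1 by rewrite mulrA xp mul1r px.
      by rewrite xa -{1}E1 -mulrBl -mulrBr pE addrAC subrr add0r.
    by apply: pos_congr; apply: pos_real; exact: ltW.
  apply: le_trans (ler_nrmM _ _) _; have := ler_nrmM (adj (uinj w)) (x * uinj a' * x).
  rewrite nrm_adj nrm_uinj; have := rnorm_ge0 w.
  have := nrm_ge0 (adj (uinj w) * (x * uinj a' * x)); nra.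
have [p [x [p_a pE xa [xp px] xB]]] := root a pa.
have [q [y [qa qE ya [yq qy] yB]]] := root b pb.
pose d := x * uinj c * y.
have d1 : nrm d <= 1.
  apply: unorm_le; split=> [//||z].
    by rewrite /d /= mulr0 mul0r ComplexField.Normc.normc0.
  (* |w|^4 = |(x w)^* c (y z)|^2 <= |w|^2 |z|^2 for w = d z *)
  rewrite mul1r; set w := uact d z.
  have := H (uact x w) (uact y z).
  have -> : amul (amul (star (uact x w)) c) (uact y z) = amul (star w) w.
    apply: uinj_inj; rewrite !uinjM -adj_uinj -!mul_uinj adjM xa.
    by rewrite -adj_uinj /w -!mul_uinj /d !mulrA.
  rewrite rnorm_cstar => /le_trans /(_ (ler_pM (rnorm_ge0 _) (rnorm_ge0 _) (xB w) (yB z))).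
  have := rnorm_ge0 w; have := rnorm_ge0 z; set r := rnorm w; set s := rnorm z => s0 r0.
  rewrite leNgt => h; rewrite leNgt; apply: contraNN h => sr.
  by rewrite [r ^+ 2 ^+ 2]expr2 ltr_pM2l ?exprn_gt0 ?ltr_pXn2r ?nnegrE //; lra.
have := pos_block_of_contraction p_a qa d1.
have -> : p * d * q = uinj c.
  have -> : p * d * q = (p * x) * uinj c * (y * q) by rewrite /d !mulrA.
  by rewrite px yq mul1r mulr1.
rewrite pE qE adj_uinj !uinjD addrACA -rscalarD -splitr.
by rewrite (addrAC _ e%:C%:A) (addrAC _ e%:C%:A).
Qed.

End Embedding.

(** * Block operators on a direct sum of modules *)

Section Forms.
Context {R : realType} {A : cstarAlgType R}.
Implicit Types H K : hermitianModType A.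

Lemma innerDl H (x y z : H) : <[x + y, z]> = <[x, z]> + <[y, z]>.
Proof. by rewrite inner_star innerDr starD -!inner_star. Qed.

Lemma inner0r H (x : H) : <[x, 0]> = 0.
Proof. by rewrite -(scale0r 0) innerZr scale0r. Qed.

Lemma inner0l H (x : H) : <[0, x]> = 0.
Proof. by rewrite inner_star inner0r star0. Qed.

Lemma inner_ractl H (x y : H) a : <[ract x a, y]> = amul (star a) <[x, y]>.
Proof. by rewrite inner_star inner_ract starM -inner_star. Qed.

(** Passing through the adjoint avoids the A-linearity of T. *)
Lemma inner_op_ract H K (T : 'L(H, K)) x y a b :
  <[T (ract x a), ract y b]> = amul (amul (star a) <[T x, y]>) b.
Proof. by rewrite inner_ract opadjP inner_ractl -opadjP. Qed.

Lemma block_form H K (S : 'L(H)) (B : 'L(K)) (C : 'L(H, K)) (u : H) (v : K) :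
  <[block_op S (adjoint C) C B (u, v), (u, v)]> =
    <[S u, u]> + <[B v, v]> + <[C u, v]> + star <[C u, v]>.
Proof.
rewrite [LHS]/(dsum_inner _ _) /dsum_inner /= !innerDl adjoint_subproof -(inner_star (C u)).
by rewrite [<[C u, v]> + _]addrC addrACA -!addrA; congr (_ + (_ + _)); rewrite addrC.
Qed.

End Forms.

Theorem theorem2p3 (R : realType) (CA : cstarAlgType R)
    (H K : hilbertModType CA)
    (H_neq0 : exists x : H, x <> 0) (K_neq0 : exists y : K, y <> 0)
    (A : 'L(H)) (B : 'L(K)) (C : 'L(H, K)) :
  let T : 'L(H \oplus K) := block_op A (adjoint C) C B in
  op_ge0 T <->
  [/\ op_ge0 A, op_ge0 B &
      forall (u : H) (v : K),
        `|<[C u, v]>| ^+ 2 <= `|<[A u, u]>| * `|<[B v, v]>|].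
Proof.
move=> T; split=> [pT|[pA pB bC] [u v]].
  have pA : op_ge0 A.
    move=> u; have := pT (u, 0); rewrite block_form !inner0r star0 !addr0.
    by [].
  have pB : op_ge0 B.
    move=> v; have := pT (0, v).
    by rewrite block_form (opadjP C) inner0l inner0r star0 add0r !addr0.
  split=> // u v; rewrite !rnormE -rmorphXn -rmorphM lecR -!nrm_uinj.
  apply: nrm_of_pos_block; try exact/cposE.
  move=> t t0; have := pT (u, ract v ((- t)%:C *: star <[C u, v]>)).
  rewrite block_form => /cposE; congr pos.
  rewrite inner_op_ract inner_ract; set c := <[C u, v]>; set b := <[B v, v]>.
  rewrite starZr !amulZl !amulZr starZr starM !starK scalerA -rmorphM mulrNN.
  rewrite -expr2 !uinjD !uinjZ !uinjM -!adj_uinj.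
  rewrite -addrA -scalerDl -rmorphD -scaleNr -rmorphN.
  by congr (_ + _ *: _); congr (_%:C); ring.
rewrite block_form; apply: pos_of_form_bound => // x y.
rewrite -!inner_op_ract; have := bC (ract u x) (ract v y).
by rewrite !rnormE -rmorphXn -rmorphM lecR.
Qed.
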